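(* Suppose $X$ is a compact Hausdorff space. Then the following are equivalent: (1) $X$ is an $\eta$-space. (2) No nonempty open $F_\sigma$ set in $X$ is an F-space. (3) $X$ has no isolated points and, for every $g\in C(X)$ with $g\neq 0$, the map $T$ on $C(X)$ defined by $T(f)=g\bar f$ is not a local multiplication.
   Context: $C(X)$ denotes the algebra of complex-valued continuous functions on $X$, and $C_R(X)$ the real-valued ones. A map $T$ on $C(X)$ is additive if $T(f+g)=T(f)+T(g)$ for all $f,g$; it is a multiplication if there is $a\in C(X)$ with $T(f)=af$ for all $f\in C(X)$; it is a local multiplication if for each $f\in C(X)$ there is $a_f\in C(X)$ with $T(f)=a_f f$. A compact Hausdorff space $X$ is an $\eta$-space if every additive local multiplication on $C(X)$ is a multiplication. An $F_\sigma$ set is a countable union of closed sets. For a completely regular Hausdorff space $S$, a cozero-set in $S$ is a set of the form $\{s\in S: f(s)\neq 0\}$ with $f\in C(S)$. A completely regular Hausdorff space $S$ is an F-space if for every cozero-set $A$ in $S$, every bounded function in $C_R(A)$ extends to a bounded function in $C_R(S)$. Subsets of $X$ carry the subspace topology. *)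

(* Defs.v *)
From HB Require Import structures.
From mathcomp Require Import all_boot all_order all_algebra.
From mathcomp Require Import all_classical all_reals all_analysis borel_hierarchy.
From mathcomp Require Import complex.

Set Implicit Arguments.
Unset Strict Implicit.
Unset Printing Implicit Defensive.

Import Order.TTheory GRing.Theory Num.Theory.
Import numFieldNormedType.Exports.

Local Open Scope classical_set_scope.
Local Open Scope ring_scope.

(* The library puts the topology of a numFieldType on its alias [K^o] and does
   not attach it to the concrete type [R[i]]; this instance is the usual
   topology of the modulus. *)
HB.instance Definition _ (R : realType) := NormedModule.copy R[i] (R[i]^o).

Notation cfun R X := (continuousType X R[i]).

Section CX_ring.
Context (R : realType) (X : topologicalType).

Definition cts_pred : {pred X -> R[i]} := mem [set f | continuous f].

Let cts_valP (f : cfun R X) : (f : X -> R[i]) \in cts_pred.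
Proof. by apply/mem_set; exact: cts_fun. Qed.

Let cts_sub (f : X -> R[i]) (fP : f \in cts_pred) : cfun R X :=
  mkcts (set_mem fP).

Let cts_rect (K : cfun R X -> Type) :
  (forall f (fP : f \in cts_pred), K (cts_sub fP)) -> forall f, K f.
Proof.
move=> Ksub f; suff -> : f = cts_sub (cts_valP f) by exact: Ksub.
exact/continuousEP.
Qed.

Let cts_subK (f : X -> R[i]) (fP : f \in cts_pred) : cts_sub fP = f :> (_ -> _).
Proof. by []. Qed.

HB.instance Definition _ := isSub.Build _ _ (cfun R X) cts_rect cts_subK.

Lemma cts_subring_closed : subring_closed cts_pred.
Proof.
split.
- by apply/mem_set => x; exact: cvg_cst.
- move=> f g /set_mem cf /set_mem cg; apply/mem_set => x.
  exact: (@cvgB _ (R[i]^o) _ _ _ f g _ _ (cf x) (cg x)).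
- move=> f g /set_mem cf /set_mem cg; apply/mem_set => x.
  exact: (@cvgM R[i] _ _ _ f g _ _ (cf x) (cg x)).
Qed.

(* Pointwise operations.  The ring is only [Pz]: it is trivial when [X] is
   empty. *)
HB.instance Definition _ :=
  GRing.SubChoice_isSubComPzRing.Build _ _ (cfun R X) cts_subring_closed.

End CX_ring.

Section conjugation.
Context (R : realType) (X : topologicalType).

Lemma normc_conjc (z : R[i]) : `|conjc z| = `|z|.
Proof. by case: z => a b; rewrite !normc_def /= sqrrN. Qed.

Lemma conjc_continuous : continuous (@conjc R : R[i] -> R[i]).
Proof.
move=> x; apply/(@cvgrPdist_lt _ R[i] R[i] (nbhs x)) => e e0.
apply: filterS (@cvgr_dist_lt _ R[i] R[i] (nbhs x) _ id x cvg_id e e0) => y.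
by rewrite /= -rmorphB normc_conjc.
Qed.

Lemma conj_cts_subproof (f : cfun R X) : continuous (fun x => conjc (f x)).
Proof.
by move=> x; apply: continuous_comp; [exact: cts_fun|exact: conjc_continuous].
Qed.

Definition conj_cts (f : cfun R X) : cfun R X := mkcts (@conj_cts_subproof f).

End conjugation.

Section multiplications.
Context (R : realType) (X : topologicalType).
Implicit Type T : cfun R X -> cfun R X.

Definition additive_map T := forall f g, T (f + g) = T f + T g.

Definition multiplication T := exists a : cfun R X, forall f, T f = a * f.

Definition local_multiplication T :=
  forall f, exists a : cfun R X, T f = a * f.

End multiplications.

Definition eta_space (R : realType) (X : topologicalType) :=
  [/\ compact [set: X], hausdorff_space X &
    forall T : cfun R X -> cfun R X,
      additive_map T -> local_multiplication T -> multiplication T].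

Definition cozero_set (R : realType) (S : topologicalType) (A : set S) :=
  exists f : cfun R S, A = [set s | f s != 0].

(* The coercion from sets to types turns [A] into a type carrying the subspace
   topology, so [continuousType A R] is the set of real continuous functions on
   the subspace [A]. *)
Definition F_space (R : realType) (S : topologicalType) :=
  [/\ completely_regular_space S, hausdorff_space S &
    forall A : set S, cozero_set R A ->
    forall h : continuousType A R, bounded_fun h ->
    exists k : continuousType S R, bounded_fun k /\
      forall a : A, k (\val a) = h a].

(* Main.v *)
Require Import Defs.
From mathcomp Require Import all_boot all_order all_algebra.
From mathcomp Require Import all_classical all_reals all_analysis borel_hierarchy.
From mathcomp Require Import complex.
From mathcomp Require Import ring lra.

Import Order.TTheory GRing.Theory Num.Theory.
Import numFieldNormedType.Exports.
Import ComplexField.Normc.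

Local Open Scope classical_set_scope.
Local Open Scope complex_scope.
Local Open Scope ring_scope.

(** The link between the three conditions is the map [f |-> g * conj f].  It is
additive, and it is not a multiplication unless [g = 0], as testing it on the
constants [1] and ['i] shows.  The proof rests on two facts.

First, [f |-> g * conj f] is a local multiplication if and only if the cozero
set [U] of [g] is an F-space.  If [U] is an F-space, then [conj f / f], which
is continuous and bounded on the cozero set of [f] in [U], extends to a bounded
continuous function [k] on [U], and [g * k], continued by zero, is the required
multiplier ([F_space_conj_local]).  Conversely, a real [h] bounded by [1] on a
cozero set [A] of [U] is the imaginary part of [conj z / z] for an explicit
bounded [z]; scaling [z] by a nonnegative function with cozero set [A] turns
it into some [f] continuous on all of the space, and the multiplier of this [f],
divided by [g], is continuous on [U] and equal to [conj z / z] on [A]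
([conj_local_F_space]).  In a compact Hausdorff space the cozero sets are the
open F-sigma sets, so the second condition says that no such map with [g <> 0]
is a local multiplication.  An isolated point would give one, with [g] the
indicator of the point.

Second, if there are no isolated points, then every additive local
multiplication has the form [f |-> a * f + g * conj f]
([additive_local_form]).  Indeed [T f x] depends only on [f x], so [T] acts at
[x] as an additive map [C -> C].  If this map were not real-linear, it would be
unbounded near [0] relative to the modulus
of its argument.  As [x] is not isolated and [T c] is continuous for each
constant [c], one could then choose points [y n] near [x], with disjoint
neighbourhoods, and constants [c n] tending to [0] fast, such that [T]
multiplies the modulus of [c n] by more than [n] at [y n].  A sum of bumps of height [c n] at [y n] has no
continuous, hence bounded, multiplier ([additive_local_real0]).

Given the form [a * f + g * conj f], the map [f |-> g * conj f] is again a local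
multiplication, so [g = 0] under the third condition, and the map is the
multiplication by [a]. *)

(** * Continuity of complex-valued functions *)

Section complex_topology.
Context {R : realType}.
Implicit Type z : R[i].

Lemma norm_normc z : `|z| = (normc z)%:C.
Proof. by case: z. Qed.

Lemma Re_continuous : continuous (@complex.Re R : R[i] -> R).
Proof.
move=> x; apply/(@cvgrPdist_lt _ R R[i] (nbhs x)) => e e0.
have e0' : 0 < e%:C by rewrite ltcR.
apply: filterS (@cvgr_dist_lt _ R[i] R[i] (nbhs x) _ id x cvg_id _ e0') => y /=.
move=> xye; rewrite -ltcR; apply: le_lt_trans xye.
by rewrite -(raddfB (@complex.Re R)) normc_ge_Re.
Qed.

Lemma cplxM_continuous (S : topologicalType) (f g : S -> R[i]) :
  continuous f -> continuous g -> continuous (fun s => f s * g s).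
Proof.
by move=> cf cg s; exact: (@cvgM R[i] _ _ _ f g _ _ (cf s) (cg s)).
Qed.

Lemma cplxV_continuous (S : topologicalType) (f : S -> R[i]) :
  continuous f -> (forall s, f s != 0) -> continuous (fun s => (f s)^-1).
Proof.
by move=> cf f0 s; exact: (@cvgV R[i] _ _ _ f _ (f0 s) (cf s)).
Qed.

Lemma Im_continuous : continuous (@complex.Im R : R[i] -> R).
Proof.
have -> : @complex.Im R = @complex.Re R \o (fun z => - 'i%C * z).
  by apply/funext => z /=; rewrite mulNr mulrC raddfN /= ReiNIm opprK.
have ci : continuous (fun z : R[i] => - 'i%C * z).
  apply: (@cplxM_continuous R[i] (cst (- 'i%C)) id) => [|x]; last exact: cvg_id.
  exact: cst_continuous.
by move=> x; apply: continuous_comp; [exact: ci|exact: Re_continuous].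
Qed.

Lemma normc_continuous : continuous (@normc R : R[i] -> R).
Proof.
move=> x; apply/(@cvgrPdist_lt _ R R[i] (nbhs x)) => e e0.
have e0' : 0 < e%:C by rewrite ltcR.
apply: filterS (@cvgr_dist_lt _ R[i] R[i] (nbhs x) _ id x cvg_id _ e0') => y /=.
move=> xye; rewrite -ltcR; apply: le_lt_trans xye.
have := @ler_dist_dist _ R[i] x y.
by rewrite !norm_normc -rmorphB /= expr0n addr0 sqrtr_sqr.
Qed.

Lemma real_complex_continuous : continuous (fun t : R => t%:C).
Proof.
move=> x; apply/(@cvgrPdist_lt _ R[i] R (nbhs x)) => e e0.
have eE : e = (complex.Re e)%:C by rewrite RRe_real // gtr0_real.
have e0' : 0 < complex.Re e by rewrite -ltcR -eE.
apply: filterS (@cvgr_dist_lt _ R R (nbhs x) _ id x cvg_id _ e0') => y /=.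
by rewrite -rmorphB normc_def /= expr0n addr0 sqrtr_sqr eE ltcR.
Qed.

Lemma complexC_continuous (S : topologicalType) (u v : S -> R) :
  continuous u -> continuous v -> continuous (fun s => (u s +i* v s)%C).
Proof.
move=> cu cv.
have -> : (fun s => (u s +i* v s)%C) =
    (fun s => (u s)%:C) \+ (fun s => 'i%C * (v s)%:C).
  by apply/funext => s; rewrite [LHS]complexE.
move=> s; apply: (@cvgD _ (R[i]^o)).
  exact: (continuous_comp (cu s) (@real_complex_continuous _)).
apply: (@cvgM R[i] _ _ _ (cst 'i%C)); first exact: cvg_cst.
exact: (continuous_comp (cv s) (@real_complex_continuous _)).
Qed.

End complex_topology.

Section cfun_basics.
Context {R : realType} {X : topologicalType}.
Implicit Types f g : cfun R X.

(** The ring operations on continuous functions are stated through a subtype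
structure; these equations make rewriting see that they are pointwise. *)
Lemma cfunD f g x : (f + g) x = f x + g x. Proof. by []. Qed.
Lemma cfunN f x : (- f) x = - f x. Proof. by []. Qed.
Lemma cfunM f g x : (f * g) x = f x * g x. Proof. by []. Qed.
Lemma cfun0 x : (0 : cfun R X) x = 0. Proof. by []. Qed.
Lemma cfun1 x : (1 : cfun R X) x = 1. Proof. by []. Qed.

Lemma conj_ctsE f x : conj_cts f x = conjc (f x). Proof. by []. Qed.

Lemma cfunP f g : (forall x, f x = g x) -> f = g.
Proof. by move=> fg; apply/continuousEP. Qed.

Definition ccst (c : R[i]) : cfun R X := mkcts (@cst_continuous X R[i] c).

Lemma ccstE c x : ccst c x = c. Proof. by []. Qed.

End cfun_basics.

(** * Separation, series, disjoint neighbourhoods and extension by zero *)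

Section topology.
Context {R : realType} {X : topologicalType}.

Lemma urysohn_function (cptX : compact [set: X]) (hausX : hausdorff_space X)
    (F V : set X) : closed F -> open V -> F `<=` V ->
  exists u : X -> R, [/\ continuous u, forall x, 0 <= u x <= 1,
    forall x, F x -> u x = 1 & forall x, ~ V x -> u x = 0].
Proof.
move=> cF oV FV; have nX := compact_normal hausX cptX.
have dis : ~` V `&` F = set0 by apply/disjoints_subset; exact: subsetC.
have /(@normal_separatorP R) /(_ _ _ (open_closedC oV) cF dis) := nX.
move=> /(@uniform_separatorP _ R)[u [cu u01 u0 u1]]; exists u; split => //.
- by move=> x; have := u01 (u x) (ex_intro2 _ _ x I erefl); rewrite /= in_itv.
- by move=> x Fx; apply: u1; exists x.
- by move=> x Vx; apply: u0; exists x.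
Qed.

(** The Weierstrass test against the geometric series of ratio [1/2]. *)
Lemma continuous_series (F : nat -> X -> R) :
  (forall n, continuous (F n)) -> (forall n x, `|F n x| <= 2^-1 ^+ n) ->
  exists2 f : X -> R, continuous f &
    forall x, series (F^~ x) n @[n --> \oo] --> f x.
Proof.
move=> cF bF; pose S n x := series (F^~ x) n.
have cS n : continuous (S n).
  elim: n => [|n IH].
    rewrite (_ : S 0%N = cst 0); first exact: cst_continuous.
    by apply/funext => x; rewrite /S seriesEnat /= big_nil.
  rewrite (_ : S n.+1 = S n \+ F n); first by move=> x; apply: cvgD; [exact: IH|exact: cF].
  by apply/funext => x; rewrite /S !seriesEnat /= big_nat_recr.
have tail n k x : `|S (n + k)%N x - S n x| <= 2 * (2^-1 ^+ n - 2^-1 ^+ (n + k)).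
  elim: k => [|k IH]; first by rewrite addn0 !subrr normr0 mulr0.
  have -> : S (n + k.+1)%N x - S n x = (S (n + k)%N x - S n x) + F (n + k)%N x.
    by rewrite /S !seriesEnat /= addnS big_nat_recr //= addrAC.
  apply: (le_trans (ler_normD _ _)); have := bF (n + k)%N x.
  rewrite addnS exprS; move: IH; set a := 2^-1 ^+ (n + k); set b := 2^-1 ^+ n.
  lra.
have cvgS x : cvgn (S^~ x).
  apply: normed_cvg; apply: series_le_cvg (bF ^~ x) _ => [n|n|].
  - exact: normr_ge0.
  - by rewrite exprn_ge0.
  - rewrite exprn_geometric; apply: is_cvg_geometric_series.
    by rewrite ger0_norm//; lra.
exists (fun x => limn (S^~ x)) => //.
have lim_tail n x : `|limn (S^~ x) - S n x| <= 2 * 2^-1 ^+ n.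
  have ct : `|S m x - S n x| @[m --> \oo] --> `|limn (S^~ x) - S n x|.
    by apply: cvg_norm; apply: cvgB; [exact: cvgS|exact: cvg_cst].
  rewrite -(cvg_lim _ ct)//; apply: limr_le; first by apply/cvg_ex; eexists; exact: ct.
  exists n => // m /= nm; rewrite -(subnKC nm); apply: (le_trans (tail _ _ _)).
  by rewrite ler_wpM2l// gerBl exprn_ge0.
move=> x; apply/(@cvgrPdist_lt _ R X (nbhs x)) => e e0.
have [n ne] : exists n, 2 * 2^-1 ^+ n < e / 3.
  have e6 : 0 < e / 6 by rewrite divr_gt0.
  have [n _ /(_ n (leqnn n)) /=] := near_infty_natSinv_expn_lt (PosNum e6).
  by rewrite div1r -exprVn => h; exists n; lra.
apply: filterS (@cvgr_dist_lt _ R X (nbhs x) _ _ _ (cS n x) (e / 3) _); last first.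
  by rewrite divr_gt0.
move=> y /= xy; have := lim_tail n x; have := lim_tail n y.
rewrite !ler_norml => /andP[? ?] /andP[? ?]; rewrite ltr_norml.
by move: xy; rewrite ltr_norml => /andP[? ?]; apply/andP; split; lra.
Qed.

(** At a non-isolated point of a Hausdorff space, one picks a point [y] different
from [x] in the current neighbourhood of [x], separates it from [x], and goes on
inside the part around [x].  The points [y n] need not converge to [x], which
may have no countable base of neighbourhoods. *)
Lemma disjoint_near (hausX : hausdorff_space X) (x : X) (W : nat -> set X) :
  ~ isolated [set: X] x -> (forall n, nbhs x (W n)) ->
  exists (y : nat -> X) (V : nat -> set X),
    [/\ forall n, open (V n), forall n, V n (y n), forall n, V n `<=` W n &
        forall n m z, V n z -> V m z -> n = m].
Proof.
move=> nix nW.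
(* A state is a stage [n] with a neighbourhood [U] of [x]; its successor holds
     the point chosen in [U], the open set around it, and the remainder of [U]. *)
have step (p : nat * set X) : exists q : X * set X * set X, nbhs x p.2 ->
    [/\ open q.1.2, q.1.2 q.1.1, q.1.2 `<=` W p.1 `&` p.2,
        nbhs x q.2 & q.2 `<=` p.2 `\` q.1.2].
  have [nU|nU] := pselect (nbhs x p.2); last by exists (x, setT, setT).
  have nWU : nbhs x (W p.1 `&` p.2) by apply: filterI.
  have [y [WUy yx]] : exists y, (W p.1 `&` p.2)° y /\ y <> x.
    apply: contrapT => ny; apply: nix; split; first exact: mem_set.
    exists ((W p.1 `&` p.2)°); first exact: nbhs_interior.
    rewrite setIT; apply/seteqP; split => [y Wy|_ ->]; last exact: nWU.
    by apply: contrapT => yx; apply: ny; exists y.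
  have := hausX; rewrite open_hausdorff => /(_ y x).
  have [/eqP //|_ /(_ isT)] := boolP (y == x).
  move=> [[A B] /= [/set_mem Ay /set_mem Bx] [oA oB /eqP AB]].
  exists (y, A `&` (W p.1 `&` p.2)°, B `&` p.2) => _ /=; split => //.
  - by apply: openI => //; exact: open_interior.
  - by move=> z [_ /interior_subset].
  - by apply: filterI => //; exact: open_nbhs_nbhs.
  - move=> z [Bz pz]; split => // -[Az _].
    by have : (A `&` B) z by []; rewrite AB.
have [s sP] := choice step.
pose U := fix U n := if n is m.+1 then (s (m, U m)).2 else [set: X].
have nU n : nbhs x (U n).
  by elim: n => [|n IH] /=; [exact: filterT|have [] := sP (n, U n) IH].
pose V n := (s (n, U n)).1.2.
exists (fun n => (s (n, U n)).1.1), V; split=> [n|n|n z|].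
- by have [] := sP (n, U n) (nU n).
- by have [] := sP (n, U n) (nU n).
- by have [_ _ h _ _] := sP (n, U n) (nU n) => /h[].
have UU n k : U (n + k)%N `<=` U n.
  elim: k => [|k IH]; first by rewrite addn0.
  rewrite addnS /= => z Uz; apply: IH.
  by have [_ _ _ _ h] := sP ((n + k)%N, U (n + k)%N) (nU (n + k)%N); have [] := h _ Uz.
have lt_dis n m z : (n < m)%N -> V n z -> V m z -> False.
  move=> nm Vn Vm; have [_ _ h _ _] := sP (m, U m) (nU m); have [_ /= Um] := h _ Vm.
  have Un : U n.+1 z by move: Um; rewrite -(subnKC nm); exact: UU.
  by have [_ _ _ _ h'] := sP (n, U n) (nU n); have [_] := h' _ Un; apply.
move=> n m z Vn Vm; have [nm|mn|//] := ltngtP n m.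
  by case: (lt_dis n m z nm Vn Vm).
by case: (lt_dis m n z mn Vm Vn).
Qed.

End topology.

(** On the open set [A] the extended function is as continuous as [g * k]; at a
point off [A] it tends to [0] because its modulus is at most [M * |g|]. *)
Lemma extend_by_zero (R : realType) (S : topologicalType) (A : set S)
    (g : cfun R S) (k : A -> R[i]) (M : R) :
  open A -> continuous k -> (forall a, normc (k a) <= M) ->
  (forall s, ~ A s -> g s = 0) ->
  exists f : cfun R S, (forall a : A, f (\val a) = g (\val a) * k a) /\
    (forall s, ~ A s -> f s = 0).
Proof.
move=> oA ck bk g0.
pose f s := if pselect (A s) is left As then g s * k (SigSub (mem_set As)) else 0.
have fA (a : A) : f (\val a) = g (\val a) * k a.
  rewrite /f; case: pselect => [As|]; last by case; exact: set_mem (valP a).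
  by congr (_ * k _); apply: val_inj.
have f0 s : ~ A s -> f s = 0 by rewrite /f; case: pselect.
suff cf : continuous f by exists (mkcts cf).
move=> s; have [As|nAs] := pselect (A s).
  pose a : A := SigSub (mem_set As).
  have cga : continuous (fun a : A => g (\val a) * k a).
    apply: (@cplxM_continuous _ A (fun a => g (\val a)) k _ ck) => b.
    apply: continuous_comp; last exact: cts_fun.
    exact: initial_continuous.
  move=> W; rewrite /= -[s]/(\val a) fA => /(cga a) [_ [[B oB <-] /= Ba] BW].
  apply: (filterS (P := A `&` B)) => [t [At Bt]|]; last first.
    by apply: open_nbhs_nbhs; split; [exact: openI|].
  rewrite /= -[t]/(\val (SigSub (mem_set At) : A)) fA.
  exact: (BW (SigSub (mem_set At)) Bt).
apply/(@cvgrPdist_lt _ R[i] S (nbhs s)) => e e0.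
have M1 : 0 < 1 + `|M| by rewrite ltr_pwDl.
have eM : 0 < e / (1 + `|M|)%:C by rewrite divr_gt0// ltcR.
apply: filterS (@cvgr_dist_lt _ R[i] S (nbhs s) _ _ _ (@cts_fun _ _ g s) _ eM).
move=> t; rewrite (f0 _ nAs) (g0 _ nAs) !sub0r !normrN => gt.
have [At|/f0 ->] := pselect (A t); last by rewrite normr0.
rewrite -[t]/(\val (SigSub (mem_set At) : A)) fA /= normrM.
apply: (@le_lt_trans _ _ (`|g t| * (1 + `|M|)%:C)).
  apply: ler_wpM2l => //; rewrite norm_normc lecR.
  apply: (le_trans (bk _)); have := ler_norm M; lra.
by rewrite -ltr_pdivlMr// ltcR.
Qed.

(** * The modulus *)

Section normc_bounds.
Context {R : realType}.
Implicit Type z : R[i].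

Lemma normc_ge0 z : 0 <= normc z. Proof. by case: z => a b /=. Qed.

Lemma normc_eq0 z : (normc z == 0) = (z == 0).
Proof. by apply/eqP/eqP => [/eq0_normc|->]; rewrite ?normc0. Qed.

Lemma real_complex_eq0 (r : R) : (r%:C == 0 :> R[i]) = (r == 0).
Proof. by rewrite eq_complex /= eqxx andbT. Qed.

Lemma Re_le_normc z : `|complex.Re z| <= normc z.
Proof. by case: z => a b /=; rewrite -sqrtr_sqr ler_wsqrtr// lerDl sqr_ge0. Qed.

Lemma Im_le_normc z : `|complex.Im z| <= normc z.
Proof. by case: z => a b /=; rewrite -sqrtr_sqr ler_wsqrtr// lerDr sqr_ge0. Qed.

Lemma normc_le_ReIm z : normc z <= `|complex.Re z| + `|complex.Im z|.
Proof.
case: z => a b /=; rewrite -(ger0_norm (addr_ge0 (normr_ge0 a) (normr_ge0 b))).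
rewrite -sqrtr_sqr ler_wsqrtr// sqrrD !real_normK ?num_real// addrAC lerDl.
by rewrite mulrn_wge0// mulr_ge0.
Qed.

Lemma normc_conj z : normc (conjc z) = normc z.
Proof. by case: z => a b /=; rewrite sqrrN. Qed.

Lemma normc_conj_div z : normc (conjc z / z) <= 1.
Proof.
have [->|z0] := eqVneq z 0; first by rewrite invr0 mulr0 normc0.
by rewrite normcM normcV normc_conj divff// normc_eq0.
Qed.

End normc_bounds.

Section bounded.
Context {R : realType} {T : Type}.

Lemma bounded_funP (h : T -> R) : bounded_fun h <-> exists M, forall t, `|h t| <= M.
Proof.
split=> [[M [_ hM]]|[M hM]].
  by exists (M + 1) => t; apply: hM => //; rewrite ltrDl.
by exists M; split => [|N MN t _ /=]; [exact: num_real|exact: le_trans (ltW MN)].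
Qed.

End bounded.

(** * Cozero F-spaces and the map f |-> g * conj f *)

Section Fspace.
Context {R : realType} {X : topologicalType}.
Implicit Types f g : cfun R X.

Lemma coz_open g : open [set x | g x != 0].
Proof.
rewrite (_ : mkset _ = (@normc R \o g) @^-1` [set r | 0 < r]).
  apply: open_comp; last exact: open_gt.
  by move=> x _; apply: continuous_comp; [exact: cts_fun|exact: normc_continuous].
by apply/seteqP; split=> x /=; rewrite lt0r normc_eq0 normc_ge0 andbT.
Qed.

(** The multiplier of [f] is [g * k], where [k] extends [conj f / f] from the
cozero set of [f] in [U] to [U]; the real and imaginary parts are extended
separately. *)
Lemma F_space_conj_local g (U : set X) : (forall x, U x <-> g x != 0) ->
  F_space R U -> local_multiplication (fun f => g * conj_cts f).
Proof.
move=> gU [_ _ ext] f.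
have oU : open U.
  rewrite (_ : U = [set x | g x != 0]); first exact: coz_open.
  by apply/seteqP; split => x /gU.
have cfv : continuous (fun s : U => f (\val s)).
  by move=> s; apply: continuous_comp; [exact: initial_continuous|exact: cts_fun].
pose A : set U := [set s | f (\val s) != 0].
have cozA : cozero_set R A by exists (mkcts cfv).
have cfvv : continuous (fun a : A => f (\val (\val a))).
  move=> a; apply: (@continuous_comp A U _ (fun a : A => \val a) (fun s : U => f (\val s))).
    exact: initial_continuous.
  exact: cfv.
pose w (a : A) : R[i] := conjc (f (\val (\val a))) / f (\val (\val a)).
have cw : continuous w.
  apply: (@cplxM_continuous R A (fun a : A => conjc (f (\val (\val a))))
    (fun a : A => (f (\val (\val a)))^-1)).
    move=> a; apply: (@continuous_comp A _ _ (fun a : A => f (\val (\val a))) (@conjc R)).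
      exact: cfvv.
    exact: conjc_continuous.
  by apply: (@cplxV_continuous R A) => // a; exact: set_mem (valP a).
have cRe : continuous (fun a => complex.Re (w a)).
  by move=> a; apply: (@continuous_comp A _ _ w); [exact: cw|exact: Re_continuous].
have cIm : continuous (fun a => complex.Im (w a)).
  by move=> a; apply: (@continuous_comp A _ _ w); [exact: cw|exact: Im_continuous].
have [|k1 [/bounded_funP[M1 k1M] k1w]] := ext A cozA (mkcts cRe).
  apply/bounded_funP; exists 1 => a.
  exact: le_trans (Re_le_normc _) (normc_conj_div _).
have [|k2 [/bounded_funP[M2 k2M] k2w]] := ext A cozA (mkcts cIm).
  apply/bounded_funP; exists 1 => a.
  exact: le_trans (Im_le_normc _) (normc_conj_div _).
pose k (s : U) := k1 s +i* k2 s.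
have ck : continuous k by apply: complexC_continuous; exact: cts_fun.
have bk s : normc (k s) <= M1 + M2.
  by apply: (le_trans (normc_le_ReIm _)); exact: lerD (k1M s) (k2M s).
have g0 x : ~ U x -> g x = 0.
  by move=> nUx; apply/eqP; apply: contrapT => /negP /gU.
have [a [aU a0]] := extend_by_zero _ _ _ g _ _ oU ck bk g0.
exists a; apply: cfunP => x; rewrite !cfunM conj_ctsE.
have [Ux|nUx] := pselect (U x); last by rewrite g0// a0// !mul0r.
have [fx0|fx0] := eqVneq (f x) 0; first by rewrite fx0 conjc0 !mulr0.
pose s : U := SigSub (mem_set Ux); have As : A s by [].
rewrite -[x]/(\val s) aU -mulrA; congr (_ * _).
pose t : A := SigSub (mem_set As).
have -> : k s = w t.
  rewrite /k -[s]/(\val t) k1w k2w.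
  rewrite -[LHS]/(complex.Re (w t) +i* complex.Im (w t)).
  by case: (w t).
by rewrite /w /= divfK.
Qed.

End Fspace.

(** * F-spaces from local multiplications *)

Section phase.
Context {R : realType}.
Implicit Type r : R.

(** For [|r| <= 1], let [v = sqrt (1 - r ^+ 2) + r * 'i] be the point of the
unit circle with imaginary part [r] and nonnegative real part; this is
[z = 1 + conj v].  As [v * conj v = 1], its conjugate is [v * z], so that
[conj z / z = v]. *)
Definition half_phase r : R[i] := (1 + Num.sqrt (1 - r ^+ 2)) -i* r.

Lemma half_phase_continuous : continuous half_phase.
Proof.
apply: complexC_continuous => r; last exact: cvgN.
apply: cvgD; first exact: cvg_cst.
apply: (@continuous_comp R R R (fun r => 1 - r ^+ 2) Num.sqrt).
  by apply: cvgB; [exact: cvg_cst|exact: exprn_continuous].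
exact: sqrt_continuous.
Qed.

Lemma half_phase_neq0 r : half_phase r != 0.
Proof. by rewrite /half_phase eq_complex /= negb_and gt_eqF// ltr_pwDl. Qed.

Lemma Im_half_phase r : `|r| <= 1 ->
  complex.Im (conjc (half_phase r) / half_phase r) = r.
Proof.
move=> r1; have c2 : Num.sqrt (1 - r ^+ 2) ^+ 2 = 1 - r ^+ 2.
  by rewrite sqr_sqrtr// subr_ge0 -real_normK ?num_real// exprn_ile1.
suff -> : conjc (half_phase r) = (Num.sqrt (1 - r ^+ 2) +i* r) * half_phase r.
  by rewrite mulfK// half_phase_neq0.
rewrite /half_phase; move: (Num.sqrt _) c2 => c c2.
apply/eqP; rewrite eq_complex /=; apply/andP; split; apply/eqP; ring: c2.
Qed.

Lemma half_phase_bound r : `|r| <= 1 -> normc (half_phase r) <= 3.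
Proof.
move=> r1; apply: (le_trans (normc_le_ReIm _)) => /=.
have c0 := sqrtr_ge0 (1 - r ^+ 2).
have : Num.sqrt (1 - r ^+ 2) <= 1.
  by rewrite -[leRHS]sqrtr1 ler_wsqrtr// gerBl sqr_ge0.
by rewrite normrN (ger0_norm (addr_ge0 ler01 c0)); lra.
Qed.

(** This truncation of the line to the interval from -1 to 1 fixes that
interval. *)
Lemma clip_continuous : continuous (fun r : R => r / Num.max 1 `|r|).
Proof.
move=> r; have m0 (s : R) : Num.max 1 `|s| != 0 by rewrite gt_eqF// lt_max ltr01.
apply: cvgM; first exact: cvg_id.
apply: cvgV => //; apply: continuous_max; first exact: cvg_cst.
exact: norm_continuous.
Qed.

Lemma clip_bound r : `|r / Num.max 1 `|r| | <= 1.
Proof.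
have m0 : 0 < Num.max 1 `|r| by rewrite lt_max ltr01.
by rewrite normrM normfV (gtr0_norm m0) ler_pdivrMr// mul1r le_max lexx orbT.
Qed.

End phase.

Lemma real_cfun (R : realType) (X : topologicalType) (u : X -> R) : continuous u ->
  exists f : cfun R X, forall x, f x = (u x)%:C.
Proof.
move=> cu; have cf : continuous (fun x => (u x)%:C).
  by move=> x; apply: continuous_comp; [exact: cu|exact: real_complex_continuous].
by exists (mkcts cf).
Qed.

Section compact_hausdorff.
Context {R : realType} {X : topologicalType}.
Hypotheses (cptX : compact [set: X]) (hausX : hausdorff_space X).
Implicit Types f g : cfun R X.

(** Each of the countably many closed sets is separated from the complement of
[U], and the separating functions are summed with weights. *)
Lemma open_Fsigma_coz (U : set X) : open U -> Fsigma U ->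
  exists g : cfun R X, forall x, U x <-> g x != 0.
Proof.
move=> oU [F cF UF].
have step n : exists u : X -> R, [/\ continuous u, forall x, 0 <= u x <= 1,
    forall x, F n x -> u x = 1 & forall x, ~ U x -> u x = 0].
  by apply: urysohn_function => //; rewrite UF; exact: bigcup_sup.
have [u uP] := choice step.
pose G n x := 2^-1 ^+ n * u n x.
have G0 n x : 0 <= G n x.
  by have [_ /(_ x) /andP[u0 _] _ _] := uP n; rewrite mulr_ge0// exprn_ge0.
have [n|n x|v cv vG] := @continuous_series R X G.
- have [cu _ _ _] := uP n; move=> x; apply: cvgM; [exact: cvg_cst|exact: cu].
- rewrite ger0_norm//; have [_ /(_ x) /andP[_ u1] _ _] := uP n.
  by rewrite ler_piMr// exprn_ge0.
have [g gv] := real_cfun _ _ v cv; exists g => x; rewrite gv real_complex_eq0.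
split=> [Ux|].
  have [n _ Fn] : (\bigcup_i F i) x by rewrite -UF.
  suff : 0 < v x by rewrite lt0r => /andP[].
  apply: (@lt_le_trans _ _ (G n x)).
    by have [_ _ u1 _] := uP n; rewrite /G u1// mulr1 exprn_gt0.
  rewrite -(cvg_lim _ (vG x))//; apply: limr_ge.
    by apply/cvg_ex; eexists; exact: vG.
  exists n.+1 => // m /= nm.
  rewrite seriesEord /= (bigD1 (Ordinal nm)) //= lerDl sumr_ge0//.
apply: contraPP => nUx; apply/negP; rewrite negbK.
rewrite -(cvg_lim _ (vG x))// (_ : series _ = cst 0) ?lim_cst//.
apply/funext => n; rewrite seriesEord /= big1// => i _.
by have [_ _ _ u0] := uP i; rewrite /G u0// mulr0.
Qed.

Lemma coz_Fsigma g : Fsigma [set x | g x != 0].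
Proof.
exists (fun n => [set x | n.+1%:R^-1 <= normc (g x)]) => [n|].
  apply: (@closed_comp _ _ (@normc R \o g) [set r | n.+1%:R^-1 <= r]).
    move=> x _; apply: continuous_comp; [exact: cts_fun|exact: normc_continuous].
  exact: closed_ge.
apply/seteqP; split => [x /= gx|x [n _ /= gn]].
  have ng : 0 < normc (g x) by rewrite lt0r normc_eq0 gx normc_ge0.
  have [n _ /(_ n (leqnn n)) /= h] := near_infty_natSinv_lt (PosNum ng).
  by exists n => //; exact: ltW.
by rewrite -normc_eq0 gt_eqF// (lt_le_trans _ gn)// invr_gt0.
Qed.

Lemma subspace_completely_regular (U : set X) : @completely_regular_space U.
Proof.
move=> a B cB nBa.
have [C oC CB] : open (~` B) by exact: closed_openC.
have Ca : C (\val a) by rewrite -[C _]/((\val @^-1` C) a) CB.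
have [||z ->|u [cu u01 u1 u0]] := @urysohn_function R X cptX hausX [set \val a] C.
- exact/accessible_closed_set1/hausdorff_accessible.
- exact: oC.
- exact: Ca.
apply/(@uniform_separatorP _ R); exists (fun s : U => 1 - u (\val s)); split.
- have cu' : continuous (fun x => 1 - u x).
    by move=> x; apply: cvgB; [exact: cvg_cst|exact: cu].
  move=> s; apply: (@continuous_comp U X R \val (fun x => 1 - u x)).
    exact: initial_continuous.
  exact: cu'.
- move=> _ [s _ <-] /=; have /andP[u0s u1s] := u01 (\val s).
  by rewrite in_itv /=; apply/andP; split; lra.
- by move=> _ [s -> <-] /=; rewrite u1// subrr.
- move=> _ [s Bs <-] /=; rewrite u0 ?subr0// => Cs.
  have : (~` B) s by rewrite -CB.
  exact.
Qed.

Lemma subspace_hausdorff_space (U : set X) : hausdorff_space U.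
Proof.
move=> s t st; apply: val_inj; apply: hausX => A B sA tB.
have [|q [Aq Bq]] := st (\val @^-1` A) (\val @^-1` B) (initial_continuous sA).
  exact: (initial_continuous tB).
by exists (\val q).
Qed.

(** To extend [h] from the cozero set [A] of [f0] in [U], one tests the local
multiplication on [f = |g| * u * z], where [z] is the half phase of a rescaling
of [h] and [u] is a truncation of [|f0|].  The factors [|g|] and [u] make [f]
continuous on the whole space, and since they are real and positive on [A] they
disappear from [conj f / f]. *)
Lemma conj_local_F_space g :
  local_multiplication (fun f => g * conj_cts f) -> F_space R [set x | g x != 0].
Proof.
set U := [set x | g x != 0] => loc; have oU : open U := coz_open g.
split; [exact: subspace_completely_regular|exact: subspace_hausdorff_space|].
move=> A [f0 Af0] h /bounded_funP[M hM].
have oA : open A by rewrite Af0; exact: coz_open.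
have AP s : A s <-> f0 s != 0 by rewrite Af0.
pose N := `|M| + 1; have N0 : 0 < N by rewrite ltr_wpDl.
pose z a := half_phase (h a / N).
have hN a : `|h a / N| <= 1.
  rewrite normrM normfV (gtr0_norm N0) ler_pdivrMr// mul1r.
  apply: le_trans (hM a) _; rewrite /N; have := ler_norm M; lra.
have cz : continuous z.
  move=> a; apply: (@continuous_comp A R _ h (fun r => half_phase (r / N))).
    exact: cts_fun.
  apply: (@continuous_comp R R _ (fun r => r / N) half_phase).
    exact: mulrr_continuous.
  exact: half_phase_continuous.
have bz a : normc (z a) <= 3 by exact: half_phase_bound.
pose clip (r : R) := r / Num.max 1 `|r|.
have cu : continuous (fun s : U => clip (normc (f0 s))).
  move=> s; apply: (@continuous_comp U R _ (fun s : U => normc (f0 s)) clip).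
    apply: (@continuous_comp U _ _ f0 (@normc R)); first exact: cts_fun.
    exact: normc_continuous.
  exact: clip_continuous.
have [u uE] := real_cfun _ _ _ cu.
have u0 s : ~ A s -> u s = 0.
  rewrite Af0 /= => /negP; rewrite negbK uE => /eqP ->.
  by rewrite normc0 /clip mul0r.
have uA (a : A) : u (\val a) != 0.
  rewrite uE real_complex_eq0 /clip mulf_neq0//.
  by rewrite normc_eq0; apply/AP; exact: set_mem (valP a).
have [f1 [f1A f10]] := extend_by_zero _ _ _ u _ _ oA cz bz u0.
have bf1 s : normc (f1 s) <= 3.
  have [As|/f10 ->] := pselect (A s); last by rewrite normc0.
  rewrite -[s]/(\val (SigSub (mem_set As) : A)) f1A normcM uE.
  rewrite -[leRHS]mul1r ler_pM ?normc_ge0 ?bz//=.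
  by rewrite expr0n addr0 sqrtr_sqr clip_bound.
have cng : continuous (fun x => normc (g x)).
  by move=> x; apply: continuous_comp; [exact: cts_fun|exact: normc_continuous].
have [gn gnE] := real_cfun _ _ _ cng.
have gn0 x : ~ U x -> gn x = 0.
  by move=> /negP; rewrite negbK gnE => /eqP ->; rewrite normc0.
have [f [fU _]] := extend_by_zero _ _ _ gn _ _ oU (@cts_fun _ _ f1) bf1 gn0.
have [a aE] := loc f.
have gU (s : U) : g (\val s) != 0 by exact: set_mem (valP s).
have cq : continuous (fun s : U => a (\val s) / g (\val s)).
  apply: (@cplxM_continuous R U (fun s => a (\val s)) (fun s => (g (\val s))^-1)).
    by move=> s; apply: continuous_comp; [exact: initial_continuous|exact: cts_fun].
  apply: (@cplxV_continuous R U (fun s => g (\val s)) _ gU).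
  by move=> s; apply: continuous_comp; [exact: initial_continuous|exact: cts_fun].
(* The imaginary part of [a / g] extends the rescaled [h], but may be
     unbounded off [A]: the truncation makes it bounded without changing it
     on [A]. *)
pose k (s : U) := clip (complex.Im (a (\val s) / g (\val s))) * N.
have ck : continuous k.
  move=> s; apply: (@continuous_comp U R R
      (fun s : U => clip (complex.Im (a (\val s) / g (\val s)))) (fun r => r * N)).
    apply: (@continuous_comp U R R
      (fun s : U => complex.Im (a (\val s) / g (\val s))) clip).
      apply: (@continuous_comp U R[i] R _ (@complex.Im R) _ (cq s)).
      exact: Im_continuous.
    exact: clip_continuous.
  exact: mulrr_continuous.
exists (mkcts ck); split.
  apply/bounded_funP; exists N => s.
  rewrite -[X in X <= _]/`|k s| normrM (gtr0_norm N0) -[leRHS]mul1r.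
  by apply: ler_wpM2r; [exact: ltW|exact: clip_bound].
move=> b; rewrite -[LHS]/(k (\val b)) /k.
have -> : a (\val (\val b)) / g (\val (\val b)) = conjc (z b) / z b.
  have := congr1 (fun f : cfun R X => f (\val (\val b))) aE.
  rewrite !cfunM conj_ctsE fU f1A => e.
  have zb : z b != 0 by exact: half_phase_neq0.
  have nb : gn (\val (\val b)) * u (\val b) != 0.
    by rewrite mulf_neq0// gnE real_complex_eq0 normc_eq0.
  apply/eqP; rewrite eqr_div//; apply/eqP; apply: (mulfI nb).
  rewrite mulrCA -mulrA -e !rmorphM /= gnE uE !conjc_real.
  ring.
rewrite /z Im_half_phase// /clip.
by rewrite max_l// divr1 divfK// gt_eqF.
Qed.

End compact_hausdorff.

(** * Additive local multiplications *)

Section additive_local.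
Context {R : realType} {X : topologicalType}.
Implicit Types (f g : cfun R X) (T S : cfun R X -> cfun R X).

(** A local multiplication kills [f - g] wherever it vanishes. *)
Lemma local_eq_at T : additive_map T -> local_multiplication T ->
  forall f g x, f x = g x -> T f x = T g x.
Proof.
move=> addT locT f g x fg; have [a aE] := locT (f - g).
rewrite -[f in LHS](subrK g) addT cfunD aE cfunM cfunD cfunN fg subrr.
by rewrite mulr0 add0r.
Qed.

Section real_constants.
Variable S : cfun R X -> cfun R X.
Hypotheses (addS : additive_map S) (S1 : S 1 = 0).
Let P (c : R) := S (ccst c%:C).

Let PD c d : P (c + d) = P c + P d.
Proof. by rewrite /P -addS; congr S; apply: cfunP => x; rewrite /= rmorphD. Qed.

Let P0 : P 0 = 0.
Proof. by apply: (addrI (P 0)); rewrite -PD !addr0. Qed.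

Let PN c : P (- c) = - P c.
Proof. by apply: (addrI (P c)); rewrite -PD !subrr P0. Qed.

Let PMn c n : P (c *+ n) = P c *+ n.
Proof. by elim: n => [|n IH]; rewrite ?mulr0n ?P0// !mulrS PD IH. Qed.

Let Pnat n : P n%:R = 0.
Proof.
rewrite PMn (_ : P 1 = 0) ?mul0rn// -S1; congr S.
by apply: cfunP => x; rewrite cfun1.
Qed.

(** An additive function of a real variable that vanishes at [1] vanishes at all
integers.  Hence the multiples [t *+ N], on which it grows with [N], may be
reduced modulo [1] without changing the value; division by [2 ^ n] then makes
the argument as small as wanted. *)
Lemma unbounded_at (t : R) (x : X) : P t x != 0 ->
  forall n : nat, exists2 c : R, `|c| <= 2^-1 ^+ n & n%:R * `|c| < normc (P c x).
Proof.
wlog t0 : t / 0 <= t => [wl|] Ptx n.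
  have [|t0] := leP 0 t; first by move=> t0; exact: wl t0 Ptx n.
  apply: (wl (- t)); first by rewrite oppr_ge0 ltW.
  by rewrite PN cfunN oppr_eq0.
have e0 : 0 < normc (P t x) by rewrite lt0r normc_eq0 Ptx normc_ge0.
have [N Nn] : exists N : nat, n%:R < normc (P t x) * N%:R.
  exists (Num.bound (n%:R / normc (P t x))).
  by rewrite mulrC -ltr_pdivrMr// archi_boundP// divr_ge0// normc_ge0.
pose r := t *+ N - (Num.truncn (t *+ N))%:R.
have /andP[r0 r1] : 0 <= r <= 1.
  have /andP[h1 h2] := truncn_itv (mulrn_wge0 N t0).
  by rewrite /r subr_ge0 h1 lerBlDl -natr1 addrC in h2 *; exact: ltW.
have Pr : P r = P t *+ N by rewrite /r PD PN Pnat oppr0 addr0 PMn.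
have normcMn (z : R[i]) k : normc (z *+ k) = normc z * k%:R.
  have nk : normc (k%:R : R[i]) = k%:R.
    by rewrite -(rmorph_nat (real_complex R)) /= expr0n addr0 sqrtr_sqr ger0_norm.
  by rewrite -[z *+ k]mulr_natr normcM nk.
have cfunMn f k : (f *+ k) x = f x *+ k.
  by elim: k => [|k IH]; rewrite ?mulr0n ?mulrS ?cfunD ?IH.
pose q := 2^-1 ^+ n * r; have q0 : 0 < 2^-1 ^+ n :> R by rewrite exprn_gt0.
have qr : r = q *+ (2 ^ n).
  by rewrite /q -mulr_natr natrX mulrC mulrA exprVn divff ?mul1r// expf_neq0.
exists q; rewrite ger0_norm ?mulr_ge0 ?(ltW q0)//; first by rewrite ler_piMr// ltW.
have e : normc (P q x) * 2 ^+ n = normc (P t x) * N%:R.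
  by rewrite -natrX -!normcMn -!cfunMn -PMn -qr Pr.
have -> : normc (P q x) = normc (P t x) * N%:R * 2^-1 ^+ n.
  by rewrite -e exprVn mulfK// expf_neq0.
rewrite mulrCA mulrC ltr_pM2r//; apply: le_lt_trans Nn.
by rewrite ler_piMr.
Qed.

End real_constants.

Hypotheses (cptX : compact [set: X]) (hausX : hausdorff_space X).
Hypothesis perfectX : forall x : X, ~ isolated [set: X] x.

(** A gliding hump: if [S] did not vanish at a real constant, then it would be
unbounded at some non-isolated point, and a sum of disjointly supported bumps
would have an unbounded multiplier. *)
Lemma additive_local_real0 S : additive_map S -> local_multiplication S ->
  S 1 = 0 -> forall t : R, S (ccst t%:C) = 0.
Proof.
move=> addS locS S1 t; apply: cfunP => x; rewrite cfun0; apply/eqP.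
apply: contrapT => /negP /(unbounded_at S addS S1 t x) unb.
have unb' n : exists c : R, `|c| <= 2^-1 ^+ n /\
    n%:R * `|c| < normc (S (ccst c%:C) x).
  by have [c c1 c2] := unb n; exists c.
have [c cP] := choice unb'.
pose W n := [set z | n%:R * `|c n| < normc (S (ccst (c n)%:C) z)].
have nW n : nbhs x (W n).
  apply: open_nbhs_nbhs; split; last by have [] := cP n.
  apply: (@open_comp _ _ (@normc R \o S (ccst (c n)%:C)) [set r | n%:R * `|c n| < r]).
    by move=> z _; apply: continuous_comp; [exact: cts_fun|exact: normc_continuous].
  exact: open_gt.
have [y [V [oV Vy VW disV]]] := disjoint_near hausX x W (perfectX x) nW.
have bump n : exists u : X -> R, [/\ continuous u, forall z, 0 <= u z <= 1,
    forall z, [set y n] z -> u z = 1 & forall z, ~ V n z -> u z = 0].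
  apply: urysohn_function => //; last by move=> z ->.
  exact/accessible_closed_set1/hausdorff_accessible.
have [u uP] := choice bump.
have [n|n z|f cf fE] := @continuous_series R X (fun n z => c n * u n z).
- have [cu _ _ _] := uP n; move=> z; apply: cvgM; [exact: cvg_cst|exact: cu].
- have [_ /(_ z) /andP[u0 u1] _ _] := uP n; have [cn _] := cP n.
  by rewrite normrM (ger0_norm u0) -[leRHS]mulr1 ler_pM.
(* The supports being disjoint, only the n-th bump is felt at [y n]. *)
have fy n : f (y n) = c n.
  rewrite -(cvg_lim _ (fE (y n)))//; apply: lim_near_cst => //.
  exists n.+1 => // m /= nm; rewrite seriesEord /= (bigD1 (Ordinal nm)) //= big1.
    by have [_ _ -> //] := uP n; rewrite addr0 mulr1.
  move=> i /eqP ni; have [_ _ _ ->] := uP i; first by rewrite mulr0.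
  by move=> Vi; apply: ni; apply: val_inj; exact: disV Vi (Vy n).
have [F FE] := real_cfun _ _ _ cf.
have [a aE] := locS F.
have [M aM] : exists M, forall z, normc (a z) <= M.
  have [||p _ pM] := @compact_EVT_max X R (@normc R \o a) setT _ cptX.
  - by exists x.
  - apply: continuous_subspaceT => z.
    by apply: continuous_comp; [exact: cts_fun|exact: normc_continuous].
  - by exists (normc (a p)) => z; apply: pM; exact: mem_set.
have [n Mn] : exists n : nat, M < n%:R.
  exists (Num.bound `|M|).
  exact: le_lt_trans (ler_norm M) (archi_boundP (normr_ge0 M)).
have := VW n _ (Vy n); rewrite /W /=.
have -> : S (ccst (c n)%:C) (y n) = S F (y n).
  by apply: local_eq_at => //; rewrite FE fy.
rewrite aE cfunM FE fy normcM /= expr0n addr0 sqrtr_sqr => h.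
have : n%:R * `|c n| < n%:R * `|c n|.
  by apply: lt_le_trans h _; rewrite ler_wpM2r// (le_trans (aM _))// ltW.
by rewrite ltxx.
Qed.

(** Real linearity at each point expresses [T f] by the values of [T] at the
constants [1] and ['i]; a real-linear map [C -> C] is a combination of the
identity and the conjugation. *)
Lemma additive_local_form T : additive_map T -> local_multiplication T ->
  exists a g, forall f, T f = a * f + g * conj_cts f.
Proof.
move=> addT locT; pose Ti := T (ccst 'i%C).
have real1 t : T (ccst t%:C) = T 1 * ccst t%:C.
  apply/eqP; rewrite -subr_eq0; apply/eqP.
  apply: (additive_local_real0 (fun f => T f - T 1 * f)) => [f g|f|].
  - by rewrite addT mulrDr opprD addrACA.
  - by have [a ->] := locT f; exists (a - T 1); rewrite mulrBl.
  - by rewrite mulr1 subrr.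
have reali t : T (ccst 'i%C * ccst t%:C) = Ti * ccst t%:C.
  apply/eqP; rewrite -subr_eq0; apply/eqP.
  apply: (additive_local_real0 (fun f => T (ccst 'i%C * f) - Ti * f)) => [f g|f|].
  - by rewrite mulrDr addT mulrDr opprD addrACA.
  - have [a ->] := locT (ccst 'i%C * f).
    by exists (a * ccst 'i%C - Ti); rewrite mulrBl mulrA.
  - by rewrite !mulr1 subrr.
exists (ccst (2^-1) * (T 1 - ccst 'i%C * Ti)), (ccst (2^-1) * (T 1 + ccst 'i%C * Ti)).
move=> f; apply: cfunP => x.
set r := complex.Re (f x); set s := complex.Im (f x).
have fx : f x = r%:C + 'i%C * s%:C by exact: complexE.
have cfx : conjc (f x) = r%:C - 'i%C * s%:C.
  rewrite /r /s; case: (f x) => p q; apply/eqP; rewrite eq_complex /=.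
  by apply/andP; split; apply/eqP; ring.
have -> : T f x = T (ccst r%:C + ccst 'i%C * ccst s%:C) x.
  by apply: local_eq_at => //; rewrite fx.
rewrite addT real1 reali !cfunD !cfunM conj_ctsE cfx fx.
have ii : 'i%C * 'i%C = -1 :> R[i] by rewrite -expr2 sqr_i.
rewrite !(cfunD, cfunM, cfunN) ![ccst _ x]ccstE.
by field: ii.
Qed.

End additive_local.

(** * The characterization *)

Theorem theorem15 (R : realType) (X : topologicalType)
    (cptX : compact [set: X]) (hausX : hausdorff_space X) :
  [<-> eta_space R X;
       forall U : set X, open U -> Fsigma U -> U !=set0 -> ~ F_space R U;
       (forall x : X, ~ isolated [set: X] x) /\
       (forall g : cfun R X, g != 0 ->
          ~ local_multiplication (fun f : cfun R X => g * conj_cts f))].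
Proof.
tfae.
- move=> [_ _ eta] U oU FU [x Ux] FsU.
  have [g gU] := @open_Fsigma_coz R X cptX hausX U oU FU.
  have addT : additive_map (fun f : cfun R X => g * conj_cts f).
    move=> f h; rewrite -mulrDr; congr (_ * _); apply: cfunP => z.
    by rewrite cfunD !conj_ctsE cfunD rmorphD.
  have [a aE] := eta _ addT (F_space_conj_local g U gU FsU).
  (* A multiplication by [a] would give [a = g] on the constant [1] and
     [a = - g] on the constant ['i], at a point where [g] is nonzero. *)
  have ga : g x = a x.
    have := congr1 (fun f : cfun R X => f x) (aE (ccst 1)).
    by rewrite !cfunM conj_ctsE ccstE conjc1 !mulr1.
  have := congr1 (fun f : cfun R X => f x) (aE (ccst 'i%C)).
  rewrite !cfunM conj_ctsE ccstE ga.
  move/(mulfI _) => h; have : conjc 'i%C = 'i%C :> R[i] by apply: h; rewrite -ga; exact/gU.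
  case => /eqP; rewrite eq_sym -subr_eq0 opprK => /eqP h2.
  have : (0 : R) < 1 + 1 by [].
  by rewrite h2 ltxx.
- move=> noF.
  have noloc (g : cfun R X) : g != 0 ->
      ~ local_multiplication (fun f : cfun R X => g * conj_cts f).
    move=> g0 loc; apply: (noF [set x | g x != 0]).
    + exact: coz_open.
    + exact: coz_Fsigma.
    + apply: contrapT => U0; move/eqP: g0; apply; apply: cfunP => x.
      rewrite cfun0; apply: contrapT => /eqP gx; apply: U0; by exists x.
    + exact: conj_local_F_space.
  split=> // x [_ [V nV]]; rewrite setIT => Vx.
  (* The indicator [g] of an isolated point [x] sees only the value of [f]
     at [x], so a constant multiple of [g] is a multiplier for [f]. *)
  have ox : open [set x] by rewrite openE => y ->; rewrite -Vx.
  have cx : closed [set x] by exact/accessible_closed_set1/hausdorff_accessible.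
  have [//|u [cu _ u1 u0]] := @urysohn_function R X cptX hausX [set x] [set x] cx ox.
  have [g gu] := real_cfun _ _ u cu.
  apply: (noloc g).
    apply/eqP => g0; have := congr1 (fun f : cfun R X => f x) g0.
    by rewrite gu cfun0 u1// => /eqP; rewrite real_complex_eq0 oner_eq0.
  move=> f; exists (g * ccst (conjc (f x) / f x)); apply: cfunP => z.
  rewrite !cfunM conj_ctsE ccstE -mulrA.
  have [->|zx] := pselect (z = x); last by rewrite gu u0// !mul0r.
  congr (_ * _); have [->|fx0] := eqVneq (f x) 0; first by rewrite conjc0 mulr0.
  by rewrite divfK.
- move=> [perf noloc]; split=> // T addT locT.
  have [a [g TE]] := additive_local_form cptX hausX perf T addT locT.
  exists a => f; rewrite TE.
  suff -> : g = 0 by rewrite mul0r addr0.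
  apply: contrapT => /eqP /noloc; apply => h.
  have [b Tb] := locT h; exists (b - a).
  by rewrite mulrBl -Tb TE addrAC subrr add0r.
Qed.
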